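(* On the semigroup $\mathscr{C}_{+}(p,q)^0$ there exist continuum many Hausdorff locally compact shift-continuous topologies up to topological isomorphism. The same holds for the semigroup $\mathscr{C}_{-}(p,q)^0$: on it there exist continuum many Hausdorff locally compact shift-continuous topologies up to topological isomorphism.
   Context: Let $\omega$ be the set of non-negative integers. The bicyclic monoid $\mathscr{C}(p,q)$ is the monoid with identity $1$ generated by two elements $p,q$ subject only to the relation $pq=1$. Its elements are uniquely written as $q^kp^l$ with $k,l\in\omega$, and the multiplication is $$q^kp^l\cdot q^mp^n=\begin{cases} q^{k-l+m}p^n, & l<m;\\ q^kp^n, & l=m;\\ q^kp^{l-m+n}, & l>m.\end{cases}$$ Define the subsemigroups $\mathscr{C}_{+}(p,q)=\{q^ip^j\in\mathscr{C}(p,q): i\leqslant j\}$ and $\mathscr{C}_{-}(p,q)=\{q^ip^j\in\mathscr{C}(p,q): i\geqslant j\}$. For $S=\mathscr{C}_{\pm}(p,q)$, the semigroup $S^0=S\cup\{0\}$ is $S$ with an adjoined zero $0\notin S$, i.e. $0\cdot x=x\cdot 0=0$ for all $x\in S^0$. A topology $\tau$ on a semigroup $S$ is shift-continuous if the multiplication $S\times S\to S$ is separately continuous, i.e. for every $s\in S$ the maps $x\mapsto sx$ and $x\mapsto xs$ are continuous. Two topologies $\tau_1,\tau_2$ on a semigroup $S$ are identified up to topological isomorphism if there is a semigroup isomorphism $S\to S$ which is a homeomorphism $(S,\tau_1)\to(S,\tau_2)$. ''Continuum many'' refers to the cardinality $2^{\aleph_0}$. *)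

(* Defs.v *)
From HB Require Import structures.
From mathcomp Require Import all_boot.
From mathcomp Require Import boolp classical_sets functions cardinality filter.
From mathcomp Require Import topology.
From mathcomp Require Import zify.

Set Implicit Arguments.
Unset Strict Implicit.
Unset Printing Implicit Defensive.

Local Open Scope classical_set_scope.
Local Open Scope group_scope.

(* [Bicyclic k l] is the normal form q^k p^l. *)
Record bicyclic := Bicyclic { qexp : nat; pexp : nat }.

Definition bicyclic_pair (x : bicyclic) := (qexp x, pexp x).
Definition pair_bicyclic (u : nat * nat) := Bicyclic u.1 u.2.

Lemma bicyclic_pairK : cancel bicyclic_pair pair_bicyclic.
Proof. by case. Qed.

HB.instance Definition _ := Countable.copy bicyclic (can_type bicyclic_pairK).

(* In the first case the exponent k - l + m is computed as k + (m - l), since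
   subtraction on [nat] is truncated and k may be less than l. *)
Definition bicyclic_mul (x y : bicyclic) :=
  let: Bicyclic k l := x in let: Bicyclic m n := y in
  if (l < m)%N then Bicyclic (k + (m - l)) n
  else if l == m then Bicyclic k n
  else Bicyclic k (l - m + n).

Lemma bicyclic_mulE k l m n :
  bicyclic_mul (Bicyclic k l) (Bicyclic m n) =
  Bicyclic (k + (m - l)) (l - m + n).
Proof.
rewrite /bicyclic_mul; case: ltngtP => [lm|ml|->]; congr Bicyclic; lia.
Qed.

Lemma bicyclic_mulA : associative bicyclic_mul.
Proof.
by move=> [a b] [c d] [e f]; rewrite !bicyclic_mulE; congr Bicyclic; lia.
Qed.

Lemma bicyclic_mul1x : left_id (Bicyclic 0 0) bicyclic_mul.
Proof. by case=> m n; rewrite bicyclic_mulE subn0 sub0n. Qed.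

Lemma bicyclic_mulx1 : right_id (Bicyclic 0 0) bicyclic_mul.
Proof. by case=> k l; rewrite bicyclic_mulE subn0 sub0n !addn0. Qed.

HB.instance Definition _ := isMonoid.Build bicyclic
  bicyclic_mulA bicyclic_mul1x bicyclic_mulx1.

Definition bic_p := Bicyclic 0 1.
Definition bic_q := Bicyclic 1 0.

Lemma bic_pq : bic_p * bic_q = 1.
Proof. by []. Qed.

Lemma bic_normal_form k l : Bicyclic k l = bic_q ^+ k * bic_p ^+ l.
Proof.
have -> : bic_q ^+ k = Bicyclic k 0.
  by elim: k => // k IH; rewrite expgS IH [LHS]bicyclic_mulE add1n subn0.
have -> : bic_p ^+ l = Bicyclic 0 l.
  by elim: l => // l IH; rewrite expgSr IH [LHS]bicyclic_mulE subn0 addn1.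
by rewrite [RHS]bicyclic_mulE subn0 addn0.
Qed.

Definition Cplus_pred : {pred bicyclic} := fun x => (qexp x <= pexp x)%N.
Definition Cminus_pred : {pred bicyclic} := fun x => (pexp x <= qexp x)%N.

Lemma Cplus_mulg_closed : mulg_closed Cplus_pred.
Proof.
move=> [k l] [m n]; rewrite !unfold_in /= => kl mn.
by rewrite [_ * _]bicyclic_mulE /=; lia.
Qed.

Lemma Cminus_mulg_closed : mulg_closed Cminus_pred.
Proof.
move=> [k l] [m n]; rewrite !unfold_in /= => kl mn.
by rewrite [_ * _]bicyclic_mulE /=; lia.
Qed.

Definition Cplus : Type := {x : bicyclic | Cplus_pred x}.
HB.instance Definition _ := SubChoice.on Cplus.
HB.instance Definition _ :=
  SubChoice_isSubSemigroup.Build bicyclic Cplus_pred Cplus Cplus_mulg_closed.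

Definition Cminus : Type := {x : bicyclic | Cminus_pred x}.
HB.instance Definition _ := SubChoice.on Cminus.
HB.instance Definition _ :=
  SubChoice_isSubSemigroup.Build bicyclic Cminus_pred Cminus Cminus_mulg_closed.

(* [None] is the adjoined zero. *)
Definition adjoin0 (S : semigroupType) : Type := option S.

Section Adjoin0.
Variable S : semigroupType.

HB.instance Definition _ := Choice.on (adjoin0 S).

Definition adjoin0_mul (x y : adjoin0 S) : adjoin0 S :=
  if (x, y) is (Some a, Some b) then Some (a * b) else None.

Lemma adjoin0_mulA : associative adjoin0_mul.
Proof. by move=> [a|] [b|] [c|] //; congr Some; apply: mulgA. Qed.

HB.instance Definition _ := isSemigroup.Build (adjoin0 S) adjoin0_mulA.

End Adjoin0.

Record topology (T : Type) := Topology {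
  opens : set (set T);
  opens_setT : opens setT;
  opens_setI : setI_closed opens;
  opens_bigcup : forall F : set (set T),
    F `<=` opens -> opens (\bigcup_(A in F) A) }.

(* The topological space (T, tau), as a type convertible to [T]. *)
Definition space (T : choiceType) (tau : topology T) : Type := T.

Section Space.
Variables (T : choiceType) (tau : topology T).

Lemma opens_bigU (I : Type) (f : I -> set T) :
  (forall i, opens tau (f i)) -> opens tau (\bigcup_i f i).
Proof.
move=> fo; rewrite -(bigcup_image setT f id).
by apply: opens_bigcup => _ [i _ <-].
Qed.

HB.instance Definition _ := Choice.copy (space tau) T.
HB.instance Definition _ := isOpenTopological.Build (space tau)
  (opens_setT tau) (@opens_setI _ tau) opens_bigU.

Lemma open_spaceE : (open : set (set (space tau))) = opens tau.
Proof. by []. Qed.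

End Space.

Definition shift_continuous (S : semigroupType) (tau : topology S) : Prop :=
  forall s : S,
    continuous ((fun x => s * x) : space tau -> space tau) /\
    continuous ((fun x => x * s) : space tau -> space tau).

Definition topologically_isomorphic (S : semigroupType) (tau1 tau2 : topology S)
    : Prop :=
  exists f g : S -> S,
    [/\ {morph f : x y / x * y}, cancel f g, cancel g f,
        continuous (f : space tau1 -> space tau2) &
        continuous (g : space tau2 -> space tau1)].

Definition lc_shift_topology (S : semigroupType) : set (topology S) :=
  [set tau | [/\ hausdorff_space (space tau),
                 locally_compact [set: space tau] &
                 shift_continuous tau]].

Definition iso_class (S : semigroupType) (tau : topology S) : set (topology S) :=
  [set tau' | topologically_isomorphic tau tau'].

Definition lc_shift_topology_classes (S : semigroupType)
    : set (set (topology S)) :=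
  [set iso_class tau | tau in @lc_shift_topology S].
Arguments lc_shift_topology_classes S : clear implicits.

(* Main.v *)
(* Upper bound: a countable locally compact Hausdorff space is first countable,
   and a choice of countable neighborhood bases at all points determines the
   topology and is coded by a set of natural numbers.

   Lower bound: if g is a nondecreasing function on the naturals, then the sets
   {0} U {q^i p^j | i <= j, j >= max(N, g i)} are the basic neighborhoods of 0
   in a locally compact Hausdorff shift-continuous topology on C_+^0 in which
   all other points are isolated. Functions g >= id which differ infinitely
   often give distinct topologies. Moreover C_+^0 has no nontrivial
   automorphism: it must fix each member of the decreasing chain of
   idempotents q^m p^m, and x = q^i p^j is determined by the idempotents e
   such that e x = x (those with m <= i) and x e = x (those with m <= j).
   Hence distinct topologies are not isomorphic. C_-^0 is anti-isomorphic to
   C_+^0 by q^i p^j |-> q^j p^i. *)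
Require Import Defs.
From mathcomp Require Import all_boot.
From mathcomp Require Import boolp classical_sets cardinality.
From mathcomp Require Import topology zify.

Set Implicit Arguments.
Unset Strict Implicit.
Unset Printing Implicit Defensive.

Local Open Scope classical_set_scope.
Local Open Scope card_scope.

(** * Upper bound: at most continuum many classes *)

(* A countable decreasing family of neighborhoods of [x] inside a compact one,
   whose members separate [x] from every other point, clusters only at [x],
   hence converges to it. *)
Lemma locally_compact_countable_nbhs_basis (T : topologicalType) (e : T -> nat)
    (x : T) :
  injective e -> hausdorff_space T -> locally_compact [set: T] ->
  exists V : nat -> set T,
    (forall k, nbhs x (V k)) /\
    (forall U, nbhs x U -> exists k, V k `<=` U).
Proof.
move=> e_inj hT lcT.
have [K] := lcT x I; rewrite withinET => xK [cK _].
have sep y : y != x -> exists W, nbhs x W /\ ~ closure W y.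
  move=> yx; apply: contrapT => /forallNP noW.
  suff: x = y by move/eqP; rewrite eq_sym (negPf yx).
  apply: hT => A B xA yB; apply: contrapT => AB0.
  by apply: (noW A); split => // /(_ _ yB).
(* [W n] takes care of the only point with code [n]; the default [setT] serves when no such point
   other than [x] exists. *)
have /choice[W xW] n : exists W, nbhs x W /\
    forall y, e y = n -> y != x -> ~ closure W y.
  have [[y [<- /sep[W [xW Wy]]]]|none] := pselect (exists y, e y = n /\ y != x).
    by exists W; split => // z /e_inj ->.
  exists setT; split; first exact: filterT.
  by move=> y yn yx; case: none; exists y.
pose V := fix V k := if k is j.+1 then V j `&` W j else K.
have xV k : nbhs x (V k).
  by elim: k => //= k IHk; apply: filterI => //; case: (xW k).
have V_decr j k : (j <= k)%N -> V k `<=` V j.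
  move=> /subnK <-; elim: (k - j)%N => //= i IHi y [/IHi].
  exact.
exists V; split => // U xU.
have PF : ProperFilter (filter_from setT V).
  apply: filter_from_proper => [|k _]; last first.
    by exists x; apply: nbhs_singleton.
  apply: filter_fromT_filter; first by exists 0.
  move=> i j; exists (maxn i j) => y Vy.
  by split; apply: V_decr Vy; lia.
have clV : cluster (filter_from setT V) = [set x].
  apply/seteqP; split => [y Vy|_ ->].
    apply: contrapT => /eqP yx.
    (* [V (e y).+1] is the first member cut down by [W (e y)], whose closure misses [y]. *)
    have [_ /(_ y erefl yx)] := xW (e y); apply => B yB.
    by apply: (Vy _ B) => //; exists (e y).+1 => //= z [].
  move=> A B [k _ kA] xB; exists x; split; last exact: nbhs_singleton.
  exact/kA/(nbhs_singleton (xV k)).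
have VK : filter_from setT V K by exists 0.
by have [k _ kU] := compact_cluster_set1 hT cK xK PF VK clV xU; exists k.
Qed.

Lemma topology_eq {T : choiceType} (t1 t2 : topology T) :
  opens t1 = opens t2 -> t1 = t2.
Proof.
case: t1 t2 => [o1 T1 I1 b1] [o2 T2 I2 b2] /= o12.
by subst o2; congr Topology; exact: Prop_irrelevance.
Qed.

Lemma opensP {T : choiceType} (t : topology T) (U : set T) :
  opens t U <-> forall x, U x -> nbhs (x : space t) U.
Proof.
have := @openE (space t).
by rewrite open_spaceE => ->.
Qed.

(** Classes are an image of the set of topologies, so it is enough to code each topology by a set of
    naturals; [e] makes the chosen bases codable. *)
Lemma iso_class_card_le (S : semigroupType) (e : S -> nat) :
  injective e -> lc_shift_topology_classes S #<= [set: set nat].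
Proof.
move=> e_inj; apply: card_le_trans (card_image_le _ _) _.
have base (t : topology S) : exists V : S -> nat -> set S,
    lc_shift_topology t ->
    forall x, (forall k, nbhs (x : space t) (V x k)) /\
      (forall U, nbhs (x : space t) U -> exists k, V x k `<=` U).
  have [[hT lcT _]|nt] := pselect (lc_shift_topology t); last first.
    by exists (fun _ _ => setT).
  have /choice[V VP] := fun x =>
    @locally_compact_countable_nbhs_basis (space t) e x e_inj hT lcT.
  by exists V.
have [V VP] := choice base.
pose code (W : S -> nat -> set S) : set nat :=
  [set n | exists x k y, n = pickle (e x, k, e y) /\ W x k y].
have codeE W x k y : code W (pickle (e x, k, e y)) = W x k y.
  apply: propext; split => [|Wy]; last by exists x, k, y.
  move=> [x' [k' [y' [/(pcan_inj pickleK)[]]]]].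
  by move=> /e_inj <- <- /e_inj <-.
apply/pcard_injP; exists (code \o V) => t1 t2 /set_mem lt1 /set_mem lt2 /= E.
have VE : V t1 = V t2.
  apply: funext => x; apply: funext => k; apply: funext => y.
  by rewrite -!codeE E.
apply/topology_eq/seteqP; split => U.
  move=> /opensP tU; apply/opensP => x /tU /(VP _ lt1 x).2[k].
  by rewrite VE => kU; apply: filterS kU _; exact: (VP _ lt2 x).1.
move=> /opensP tU; apply/opensP => x /tU /(VP _ lt2 x).2[k].
by rewrite -VE => kU; apply: filterS kU _; exact: (VP _ lt1 x).1.
Qed.

(** * Topologies in which all nonzero points are isolated *)

(* Every point but [None] is isolated; [F] is the trace on [S] of the
   neighborhood filter of [None]. *)
Definition zero_opens {S : Type} (F : set_system S) : set (set (option S)) :=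
  [set U | U None -> F (Some @^-1` U)].

Lemma zero_opensI (S : Type) (F : set_system S) :
  Filter F -> setI_closed (zero_opens F).
Proof. by move=> FF U V FU FV [/FU ? /FV ?]; apply: filterI. Qed.

Lemma zero_opens_bigcup (S : Type) (F : set_system S) : Filter F ->
  forall G : set (set (option S)),
    G `<=` zero_opens F -> zero_opens F (\bigcup_(U in G) U).
Proof.
by move=> FF G GF [U GU /(GF _ GU)]; apply: filterS => x Ux; exists U.
Qed.

Definition zero_topology (S : semigroupType) (F : set_system S)
    (FF : Filter F) : topology (adjoin0 S) :=
  @Topology (adjoin0 S) (zero_opens F) (fun=> filterT)
    (zero_opensI FF) (zero_opens_bigcup FF).

(** Beyond the filter axioms, the conditions yield in turn the Hausdorff property, a compact
    neighborhood of zero, and continuity of shifts at zero. *)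
Definition shift_filter {S : semigroupType} (F : set_system S) : Prop :=
  [/\ Filter F,
      forall x, F (~` [set x]),
      exists2 K, F K & forall U, F U -> finite_set (K `\` U) &
      forall s U, F U -> F [set x | U (s * x)%g] /\ F [set x | U (x * s)%g]].

Lemma lc_shift_zero_topology (S : semigroupType) (F : set_system S)
    (FF : Filter F) :
  shift_filter F -> lc_shift_topology (zero_topology FF).
Proof.
move=> [_ F1 [K FK Kfin] Fshift].
set t := zero_topology FF.
have isolated (x : S) : opens t [set Some x] by [].
have pointed U : F U -> opens t (None |` Some @` U).
  by move=> FU _; apply: filterS FU => x Ux; right; exists x.
have hT : hausdorff_space (space t).
  have sep0 (x : S) : opens t (~` [set Some x]).
    by move=> _; apply: filterS (F1 x) => y yx [].
  rewrite open_hausdorff => -[x|] [y|] // xy.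
  - exists ([set Some x], [set Some y]) => /=; rewrite ?inE; split => //.
    by rewrite -subset0 => z [-> [yx]]; rewrite yx eqxx in xy.
  - exists ([set Some x], ~` [set Some x]) => /=; rewrite ?inE; split => //.
      exact: sep0.
    exact: setICr.
  - exists (~` [set Some y], [set Some y]) => /=; rewrite ?inE; split => //.
      exact: sep0.
    exact: setICl.
have compactK : compact (None |` Some @` K : set (space t)).
  move=> G PG GK; have [cN|] := pselect (cluster G (None : space t)).
    by exists None; split => //; left.
  (* A filter not clustering at [None] has a member missing a neighborhood [V] of [None]; only
     finitely many points of [K] lie outside [V], so a cluster point exists among them. *)
  move=> /existsNP[A /existsNP[B /not_implyP[GA /not_implyP[nB AB0]]]].
  move: nB; rewrite nbhsE => -[V [oV VN] VB].
  have Vfin : finite_set (Some @` (K `\` Some @^-1` V)).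
    exact/finite_image/Kfin/oV.
  have [|y [[x [Kx _] <-] Gx]] := @finite_compact (space t) _ Vfin G.
  - apply: filterS (filterI GA GK) => y [Ay [yN|[x Kx xy]]].
      by case: AB0; exists y; split => //; apply: VB; rewrite yN.
    exists x => //; split => // Vx; case: AB0; exists y; split => //.
    by apply: VB; rewrite -xy.
  - by exists (Some x); split => //; right; exists x.
split => //.
  move=> x _; rewrite withinET; case: x => [x|].
    exists [set Some x].
      by apply: open_nbhs_nbhs; split; first exact: isolated.
    by split; [|apply: compact_closed => //]; exact: compact_set1.
  exists (None |` Some @` K); last by split => //; exact: compact_closed.
  by apply: open_nbhs_nbhs; split; [exact: pointed|left].
move=> s; split; apply/continuousP => U; rewrite open_spaceE => tU.
  case: s => [s|] UN; last by apply: filterS filterT => x _; exact: UN.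
  exact: (Fshift s _ (tU UN)).1.
case: s => [s|] UN; last by apply: filterS filterT => x _; exact: UN.
exact: (Fshift s _ (tU UN)).2.
Qed.

(** Testing openness on [U] with zero added recovers the filter. *)
Lemma zero_topology_inj (S : semigroupType) (F G : set_system S)
    (FF : Filter F) (FG : Filter G) :
  opens (zero_topology FF) = opens (zero_topology FG) -> F = G.
Proof.
move=> FG_opens; apply: funext => U.
pose U0 : set (adjoin0 S) := None |` Some @` U.
have U0E : Some @^-1` U0 = U.
  apply/seteqP; split => x; last by right; exists x.
  by case=> // -[y Uy [<-]].
have /(congr1 (fun O => O U0)) := FG_opens.
rewrite /= /zero_opens /= U0E => UFG.
by apply: propext; split => WU;
  [have : U0 None -> G U by rewrite -UFG|have : U0 None -> F U by rewrite UFG];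
  apply; left.
Qed.

(** * Rigidity and the lower bound *)

Definition automorphism (S : semigroupType) (f : S -> S) : Prop :=
  {morph f : x y / (x * y)%g} /\ bijective f.

(** By rigidity, an isomorphism between two of these topologies is the identity, so distinct filters
    give distinct classes. *)
Lemma set_nat_card_le_iso_class (S : semigroupType)
    (F : set nat -> set_system S) :
  (forall A, shift_filter (F A)) -> injective F ->
  (forall f : adjoin0 S -> adjoin0 S, automorphism f -> f =1 id) ->
  [set: set nat] #<= lc_shift_topology_classes (adjoin0 S).
Proof.
move=> Fshift F_inj rigid.
have FF A : Filter (F A) by case: (Fshift A).
pose c A := iso_class (zero_topology (FF A)).
have c_inj : injective c.
  move=> A B cAB.
  have : c B (zero_topology (FF B)).
    by exists id, id; split => // x; exact: cvg_id.
  rewrite -cAB => -[f [g [fM fK gK fc gc]]].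
  have /funext f1 : f =1 id by apply: rigid; split => //; exists g.
  have /funext g1 : g =1 id by move=> x; rewrite -[RHS]fK f1.
  subst f g; apply/F_inj/zero_topology_inj/seteqP.
  by split; [move/continuousP: gc|move/continuousP: fc].
rewrite -(card_le_eql (inj_card_eq (in2W c_inj))).
apply: subset_card_le => _ [A _ <-].
by exists (zero_topology (FF A)) => //; exact: lc_shift_zero_topology.
Qed.

(** * Exponents and staircase filters on [Cplus] *)

Definition cq (x : Cplus) : nat := qexp (\val x).
Definition cp (x : Cplus) : nat := pexp (\val x).

Lemma cqM (x y : Cplus) : cq (x * y)%g = (cq x + (cq y - cp x))%N.
Proof.
rewrite /cq /cp valM; case: (\val x) (\val y) => [k l] [m n].
by rewrite [(_ * _)%g]bicyclic_mulE.
Qed.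

Lemma cpM (x y : Cplus) : cp (x * y)%g = (cp x - cq y + cp y)%N.
Proof.
rewrite /cq /cp valM; case: (\val x) (\val y) => [k l] [m n].
by rewrite [(_ * _)%g]bicyclic_mulE.
Qed.

Lemma Cplus_eq (x y : Cplus) : cq x = cq y -> cp x = cp y -> x = y.
Proof.
move=> q p; apply: val_inj; move: q p; rewrite /cq /cp.
by case: (\val x) (\val y) => [k l] [m n] /= -> ->.
Qed.

Lemma Cplus_le (x : Cplus) : (cq x <= cp x)%N.
Proof. exact: (valP x). Qed.

(* [cplus i d] is q^i p^(i+d). *)
Definition cplus (i d : nat) : Cplus :=
  exist _ (Bicyclic i (i + d)) (leq_addr d i).

Lemma cq_cplus i d : cq (cplus i d) = i. Proof. by []. Qed.

Lemma cp_cplus i d : cp (cplus i d) = (i + d)%N. Proof. by []. Qed.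

Definition cplusE := (cqM, cpM, cq_cplus, cp_cplus).

Definition Cplus_filter (g : nat -> nat) : set_system Cplus :=
  [set U | exists N, forall x : Cplus, (N <= cp x)%N ->
     (g (cq x) <= cp x)%N -> U x].

Lemma Cplus_shift_filter (g : nat -> nat) :
  {homo g : m n / (m <= n)%N} -> shift_filter (Cplus_filter g).
Proof.
move=> g_mono; split.
- split; first by exists 0.
    move=> U V [M UM] [N VN]; exists (maxn M N) => x; rewrite geq_max.
    by move=> /andP[Mx Nx] gx; split; [exact: UM|exact: VN].
  by move=> U V UV [N UN]; exists N => x Nx gx; exact/UV/UN.
- by move=> x; exists (cp x).+1 => y + _ yx; rewrite yx ltnn.
- exists [set x : Cplus | (g (cq x) <= cp x)%N].
    by exists 0.
  move=> U [N UN].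
  pose f (u : 'I_N * 'I_N) := cplus u.1 (u.2 - u.1).
  apply: (@sub_finite_set _ _ (range f)); last first.
    exact: finite_image.
  move=> x [gx Ux]; have xN : (cp x < N)%N.
    by rewrite ltnNge; apply/negP => Nx; exact/Ux/UN.
  have xq := Cplus_le x.
  exists (Ordinal (leq_ltn_trans xq xN), Ordinal xN) => //.
  by apply: Cplus_eq; rewrite /f cplusE //= subnKC.
- move=> s U [N UN]; split.
    exists (maxn N (g (cq s))) => x Nx gx.
    apply: UN; rewrite !cplusE; first by have := Cplus_le x; lia.
    (* If [cp s <= cq x], the left shift does not raise [cq], and monotonicity of [g] applies;
       otherwise [cq (s * x)] is the constant [cq s], covered by the term [g (cq s)] of the
       bound. *)
    have [sx|sx] := leqP (cp s) (cq x); last first.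
      have -> : (cq s + (cq x - cp s) = cq s)%N by lia.
      by lia.
    have /g_mono : (cq s + (cq x - cp s) <= cq x)%N.
      by have := Cplus_le s; lia.
    by lia.
  (* Adding [cq s] ensures [cq s <= cp x], so the right shift keeps [cq x] and does not lower
     [cp x]. *)
  exists (N + cq s)%N => x Nx gx; have := Cplus_le s => qps.
  apply: UN; rewrite !cplusE; first by lia.
  have -> : (cq x + (cq s - cp x) = cq x)%N by lia.
  by lia.
Qed.

(* [logn 2 i.+1] takes each value for infinitely many [i], so the staircases of
   distinct sets differ infinitely often. *)
Definition staircase (A : set nat) (i : nat) : nat :=
  i.*2 + `[< A (logn 2 i.+1) >].

Lemma staircase_mono A : {homo staircase A : m n / (m <= n)%N}.
Proof.
move=> m n; rewrite leq_eqVlt => /predU1P[->//|mn].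
by rewrite /staircase; case: `[< _ >]; lia.
Qed.

Lemma Cplus_filter_staircase_inj :
  injective (fun A => Cplus_filter (staircase A)).
Proof.
suff sub A B :
    Cplus_filter (staircase A) = Cplus_filter (staircase B) -> A `<=` B.
  by move=> A B AB; apply/seteqP; split; apply: sub.
move=> AB n An; apply: contrapT => nB.
pose K := [set x : Cplus | (staircase A (cq x) <= cp x)%N].
have : Cplus_filter (staircase A) K by exists 0.
rewrite AB => -[N KN].
(* Chosen so that [i >= N] and [i.+1] has 2-adic valuation [n]. *)
pose i := (2 ^ n * (N.*2.+1)).-1.
have iE : i.+1 = (2 ^ n * (N.*2.+1))%N by rewrite prednK // muln_gt0 expn_gt0.
have logi : logn 2 i.+1 = n.
  rewrite iE lognM ?expn_gt0 // pfactorK // logn_coprime ?addn0 //.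
  by rewrite coprime2n /= odd_double.
have Ni : (N <= i)%N.
  rewrite -ltnS iE; apply: leq_trans (leq_pmull _ _); last by rewrite expn_gt0.
  by lia.
(* The element $q^i p^{2i}$ lies exactly on the staircase of [B] and one below that of [A]. *)
have := KN (cplus i i); rewrite /K /staircase /= !cplusE logi.
by rewrite (asboolT An) (asboolF nB); lia.
Qed.

(** * Automorphisms of [adjoin0 Cplus] *)

Lemma automorphism0 (S : semigroupType) (f : adjoin0 S -> adjoin0 S) :
  automorphism f -> f None = None.
Proof.
move=> [fM [g fK gK]].
pose z : adjoin0 S := None; have := fM z (g z); rewrite gK.
by rewrite [(f z * z)%g]/(adjoin0_mul _ _) /adjoin0_mul; case: (f z).
Qed.

Lemma automorphism_inv (S : semigroupType) (f g : S -> S) :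
  {morph f : x y / (x * y)%g} -> cancel f g -> cancel g f -> automorphism g.
Proof.
move=> fM fK gK; split; last by exists f.
by move=> x y; apply: (can_inj fK); rewrite fM !gK.
Qed.

(* The idempotent q^m p^m. *)
Definition idem (m : nat) : adjoin0 Cplus := Some (cplus m 0).

Lemma idem_inj : injective idem.
Proof. by move=> m n []. Qed.

Lemma Cplus0_idempotent (x : adjoin0 Cplus) :
  (x * x)%g = x -> x = None \/ exists m, x = idem m.
Proof.
case: x => [x|_]; last by left.
move=> [/(congr1 cp)]; rewrite !cplusE => xx; right.
exists (cq x); congr Some; apply: Cplus_eq; rewrite cplusE //.
by have := Cplus_le x; lia.
Qed.

Lemma idemMl k (x : Cplus) :
  (idem k * (Some x : adjoin0 Cplus))%g = Some x <-> (k <= cq x)%N.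
Proof.
split=> [[/(congr1 cq)]|kx].
  by rewrite !cplusE; lia.
by congr Some; apply: Cplus_eq; rewrite !cplusE; lia.
Qed.

Lemma idemMr k (x : Cplus) :
  ((Some x : adjoin0 Cplus) * idem k)%g = Some x <-> (k <= cp x)%N.
Proof.
split=> [[/(congr1 cp)]|kx].
  by rewrite !cplusE; lia.
by congr Some; apply: Cplus_eq; rewrite !cplusE; lia.
Qed.

(** Products express the order of the idempotents, so [f] induces a strictly increasing map on their
    indices, which dominates the identity. *)
Lemma automorphism_idem_ge (f : adjoin0 Cplus -> adjoin0 Cplus) m :
  automorphism f -> exists2 n, (m <= n)%N & f (idem m) = idem n.
Proof.
move=> fA; have [fM /bij_inj f_inj] := fA.
have idemM k : (idem k * idem k)%g = idem k by apply/idemMl.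
have f_idem k : exists n, f (idem k) = idem n.
  have /Cplus0_idempotent[fk|//] : (f (idem k) * f (idem k))%g = f (idem k).
    by rewrite -fM idemM.
  by have : idem k = None by apply: f_inj; rewrite fk automorphism0.
elim: m => [|m [n mn fm]]; first by have [n ->] := f_idem 0; exists n.
have [n' fm'] := f_idem m.+1; exists n' => //.
have /idemMl nn' : (idem n * idem n')%g = idem n'.
  by rewrite -fm -fm' -fM; congr f; apply/idemMl => /=.
rewrite (leq_ltn_trans mn) // ltn_neqAle nn' andbT.
apply/eqP => nE; have : m = m.+1 by apply/idem_inj/f_inj; rewrite fm fm' nE.
by lia.
Qed.

(** Neither [f] nor its inverse lowers the index of an idempotent. *)
Lemma automorphism_idem (f : adjoin0 Cplus -> adjoin0 Cplus) m :
  automorphism f -> f (idem m) = idem m.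
Proof.
move=> fA; have [fM [g fK gK]] := fA.
have [n mn fm] := automorphism_idem_ge m fA.
have [k nk] := automorphism_idem_ge n (automorphism_inv fM fK gK).
rewrite -fm fK => /idem_inj mk.
by rewrite fm; congr idem; lia.
Qed.

(** Each exponent is the largest index of an idempotent acting trivially on that side, and [f] fixes
    all idempotents. *)
Lemma automorphism_exp_ge (f : adjoin0 Cplus -> adjoin0 Cplus) x y :
  automorphism f -> f (Some x) = Some y ->
  (cq x <= cq y)%N /\ (cp x <= cp y)%N.
Proof.
move=> fA fx; have [fM _] := fA; split.
  apply/idemMl; rewrite -fx -(automorphism_idem _ fA) -fM.
  by congr f; exact/idemMl.
apply/idemMr; rewrite -fx -(automorphism_idem _ fA) -fM.
by congr f; exact/idemMr.
Qed.

Lemma Cplus0_rigid (f : adjoin0 Cplus -> adjoin0 Cplus) :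
  automorphism f -> f =1 id.
Proof.
move=> fA; have [fM [g fK gK]] := fA.
case=> [x|]; last exact: automorphism0.
have gA := automorphism_inv fM fK gK.
case fx: (f (Some x)) => [y|]; last first.
  by have := fK (Some x); rewrite fx automorphism0.
have gy : g (Some y) = Some x by rewrite -fx fK.
have [q1 p1] := automorphism_exp_ge fA fx.
have [q2 p2] := automorphism_exp_ge gA gy.
by congr Some; apply: Cplus_eq; lia.
Qed.

(** * Transfer to [Cminus] along an anti-isomorphism *)

Section AntiIsomorphism.
Variables (S T : semigroupType) (phi : S -> T) (psi : T -> S).
Hypotheses (phiM : forall x y, phi (x * y)%g = (phi y * phi x)%g)
           (phiK : cancel phi psi) (psiK : cancel psi phi).

(** Reversing products exchanges the left and right shift conditions. *)
Lemma shift_filter_anti (F : set_system S) :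
  shift_filter F -> shift_filter (phi @ F).
Proof.
move=> [FF F1 [K FK Kfin] Fshift]; split.
- exact: fmap_filter.
- move=> y; apply: (@filterS _ F) (F1 (psi y)) => x xy /= phix.
  by apply: xy => /=; rewrite -phix phiK.
- exists (phi @` K); first by apply: (@filterS _ F) FK => x Kx; exists x.
  move=> U FU; apply: sub_finite_set (finite_image phi (Kfin _ FU)).
  by move=> _ [[x Kx <-] nU]; exists x.
- move=> s U FU; have [Fl Fr] := Fshift (psi s) _ FU.
  by split; [apply: (@filterS _ F) Fr|apply: (@filterS _ F) Fl] => x /=;
    rewrite phiM psiK.
Qed.

(** Conjugation by the anti-isomorphism reverses products twice, so it carries automorphisms to
    automorphisms. *)
Lemma rigid_anti :
  (forall f : adjoin0 S -> adjoin0 S, automorphism f -> f =1 id) ->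
  forall f : adjoin0 T -> adjoin0 T, automorphism f -> f =1 id.
Proof.
move=> rigid f [fM f_bij] y.
pose phi0 : adjoin0 S -> adjoin0 T := omap phi.
pose psi0 : adjoin0 T -> adjoin0 S := omap psi.
have phi0K : cancel phi0 psi0 by case=> //= x; rewrite phiK.
have psi0K : cancel psi0 phi0 by case=> //= x; rewrite psiK.
have phi0M u v : phi0 (u * v)%g = (phi0 v * phi0 u)%g.
  by case: u v => [u|] [v|] //; congr Some; exact: phiM.
have /rigid/(_ (psi0 y)) : automorphism (psi0 \o f \o phi0).
  split; last first.
    have bphi := Bijective phi0K psi0K; have bpsi := Bijective psi0K phi0K.
    exact: (bij_comp (bij_comp bpsi f_bij) bphi).
  move=> u v; apply: (can_inj phi0K).
  by rewrite /= psi0K phi0M fM phi0M !psi0K.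
by move=> /(congr1 phi0) /=; rewrite !psi0K.
Qed.

End AntiIsomorphism.

Definition Cplus_mirror (x : Cplus) : Cminus :=
  exist _ (Bicyclic (cp x) (cq x)) (valP x).
Definition Cminus_mirror (x : Cminus) : Cplus :=
  exist _ (Bicyclic (pexp (\val x)) (qexp (\val x))) (valP x).

Lemma Cplus_mirrorK : cancel Cplus_mirror Cminus_mirror.
Proof. by move=> x; apply: Cplus_eq. Qed.

Lemma Cminus_mirrorK : cancel Cminus_mirror Cplus_mirror.
Proof. by case=> -[k l] kl; apply: val_inj. Qed.

Lemma Cplus_mirrorM x y :
  Cplus_mirror (x * y)%g = (Cplus_mirror y * Cplus_mirror x)%g.
Proof.
apply: val_inj; rewrite valM /= [RHS]bicyclic_mulE cqM cpM.
by congr Bicyclic; rewrite addnC.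
Qed.

Theorem theorem9 :
  lc_shift_topology_classes (adjoin0 Cplus) #= [set: set nat] /\
  lc_shift_topology_classes (adjoin0 Cminus) #= [set: set nat].
Proof.
have shiftF A : shift_filter (Cplus_filter (staircase A)).
  exact/Cplus_shift_filter/staircase_mono.
split; apply: Cantor_Bernstein.
- have pickle_inj := pcan_inj (@pickleK (adjoin0 Cplus)).
  exact: (@iso_class_card_le (adjoin0 Cplus) _ pickle_inj).
- apply: set_nat_card_le_iso_class shiftF Cplus_filter_staircase_inj _.
  exact: Cplus0_rigid.
- have pickle_inj := pcan_inj (@pickleK (adjoin0 Cminus)).
  exact: (@iso_class_card_le (adjoin0 Cminus) _ pickle_inj).
- apply: (set_nat_card_le_iso_class
    (F := fun A => Cplus_mirror @ Cplus_filter (staircase A))).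
  + move=> A; apply: shift_filter_anti (shiftF A).
    * exact: Cplus_mirrorM.
    * exact: Cplus_mirrorK.
    * exact: Cminus_mirrorK.
  + move=> A B AB; apply: Cplus_filter_staircase_inj; apply: funext => U /=.
    (* Testing on the preimage of [U] under [Cminus_mirror] undoes the image filter. *)
    have /= := congr1 (fun G => G (Cminus_mirror @^-1` U)) AB.
    rewrite /fmap /= -comp_preimage.
    have -> // : Cminus_mirror \o Cplus_mirror = id.
    by apply: funext; exact: Cplus_mirrorK.
  + exact: rigid_anti Cplus_mirrorM Cplus_mirrorK Cminus_mirrorK Cplus0_rigid.
Qed.
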